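(* Let $X_1$ and $X_2$ be finite simplicial complexes with free fundamental groups and a common universal cover. Then $X_1$ and $X_2$ have a common finite cover.
   Context: The complexes $X_1$, $X_2$ are connected. Everything is in the category of simplicial complexes: universal covers carry the lifted simplicial structure, ''a common universal cover'' means that the universal covers of $X_1$ and $X_2$ are isomorphic as simplicial complexes, and ''a common finite cover'' is a finite simplicial complex that admits simplicial covering maps to both $X_1$ and $X_2$. *)

(* Defs.v *)
From HB Require Import structures.
From Stdlib Require Import Relation_Operators.
From mathcomp Require Import all_boot finmap.
From mathcomp Require Import boolp classical_sets functions cardinality.

Set Implicit Arguments.
Unset Strict Implicit.
Unset Printing Implicit Defensive.

Local Open Scope classical_set_scope.

(* Simplices are nonempty finite sets of vertices, and every element of the
   vertex type is a vertex.  The vertex type may be infinite and the complex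
   need not be locally finite. *)
Record complex := Complex {
  vertex :> choiceType;
  simplex : pred {fset vertex};
  simplex_neq0 : forall s, simplex s -> s != fset0;
  simplex_sub : forall s t, simplex s -> (t `<=` s)%fset -> t != fset0 ->
    simplex t;
  simplex_vertex : forall v : vertex, simplex [fset v]%fset
}.

Definition finite_complex (K : complex) : Prop :=
  finite_set [set s | simplex (c := K) s].

Definition simplicial (K L : complex) (f : K -> L) : Prop :=
  forall s, simplex s -> simplex [fset f v | v in s]%fset.

Definition star (K : complex) (v : K) : set {fset K} :=
  [set s | simplex s && (v \in s)].

(* A simplicial map is a covering when it is surjective and sends the star of
   each vertex isomorphically onto the star of the image.  In particular an
   edge is never collapsed, two vertices over the same point have disjoint open
   stars, and the open star of each vertex of [L] is evenly covered by the open
   stars of the vertices above it. *)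
Definition simplicial_covering (K L : complex) (p : K -> L) : Prop :=
  [/\ simplicial p,
      forall w : L, exists v : K, p v = w &
      forall v : K,
        set_bij (star v) (star (p v)) (fun s => [fset p u | u in s]%fset)].

Definition complex_iso (K L : complex) : Prop :=
  exists (f : K -> L) (g : L -> K),
    [/\ cancel f g, cancel g f, simplicial f & simplicial g].

Section EdgePaths.
Variable K : complex.

(* Degenerate edges [edge x x] are allowed. *)
Definition edge : rel K := fun x y => simplex [fset x; y]%fset.

Definition connected_complex : Prop :=
  (exists v : K, True) /\
  forall x y : K, exists2 s : seq K, path edge x s & last x s = y.

(* Elementary moves between edge paths, given by their full vertex sequences:
   dropping a repeated vertex, and replacing two edges of a simplex [x, y, z]
   (possibly degenerate) by the third one. *)
Inductive edge_move : seq K -> seq K -> Prop :=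
| EdgeStutter s t x : edge_move (s ++ [:: x, x & t]) (s ++ x :: t)
| EdgeTriangle s t x y z : simplex [fset x; y; z]%fset ->
    edge_move (s ++ [:: x, y, z & t]) (s ++ [:: x, z & t]).

Definition edge_homotopy : seq K -> seq K -> Prop :=
  clos_refl_sym_trans (seq K) edge_move.

Lemma edge_homotopy_cat (a b s t : seq K) :
  edge_homotopy s t -> edge_homotopy (a ++ s ++ b) (a ++ t ++ b).
Proof.
elim=> [_ _ [{}s {}t x|{}s {}t x y z sxyz]|{}s|{}s {}t _ IH|{}s {}t u _ IH1 _ IH2].
- by apply: rst_step; rewrite -!catA !(catA a); exact: EdgeStutter.
- by apply: rst_step; rewrite -!catA !(catA a); exact: EdgeTriangle.
- exact: rst_refl.
- exact: rst_sym.
- exact: rst_trans IH1 IH2.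
Qed.

Lemma edgexx x : edge x x.
Proof. by rewrite /edge fsetUid simplex_vertex. Qed.

Lemma edge_sym : symmetric edge.
Proof. by move=> x y; rewrite /edge fsetUC. Qed.

Variable x0 : K.

(* An edge loop at [x0] is represented by the sequence of its vertices after
   the initial [x0]. *)
Definition edge_loop : Type :=
  {s : seq K | path edge x0 s && (last x0 s == x0)}.
HB.instance Definition _ := Choice.on edge_loop.

Definition loop_homotopy : rel edge_loop :=
  fun p q => `[< edge_homotopy (x0 :: val p) (x0 :: val q) >].

Lemma loop_homotopy_refl : reflexive loop_homotopy.
Proof. by move=> p; apply/asboolP; exact: rst_refl. Qed.

Lemma loop_homotopy_sym : symmetric loop_homotopy.
Proof. by move=> p q; apply/asboolP/asboolP; exact: rst_sym. Qed.

Lemma loop_homotopy_trans : transitive loop_homotopy.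
Proof.
move=> q p r /asboolP pq /asboolP qr; apply/asboolP; exact: rst_trans pq qr.
Qed.

Canonical loop_homotopy_equiv :=
  EquivRel loop_homotopy loop_homotopy_refl loop_homotopy_sym
    loop_homotopy_trans.

Definition pi1 : Type := {eq_quot loop_homotopy}%qT.
HB.instance Definition _ := Choice.on pi1.
HB.instance Definition _ := EqQuotient.on pi1.

Lemma loop1_subproof : path edge x0 [::] && (last x0 [::] == x0).
Proof. by rewrite /=. Qed.

Definition loop1 : edge_loop := Sub [::] loop1_subproof.

Lemma loopM_subproof (p q : edge_loop) :
  path edge x0 (val p ++ val q) && (last x0 (val p ++ val q) == x0).
Proof.
case: p q => [p /andP[Pp /eqP lp]] [q /andP[Pq lq]] /=.
by rewrite cat_path last_cat lp Pp Pq.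
Qed.

Definition loopM (p q : edge_loop) : edge_loop :=
  Sub (val p ++ val q) (loopM_subproof p q).

Lemma loopV_subproof (p : edge_loop) :
  path edge x0 (rev (belast x0 (val p))) &&
  (last x0 (rev (belast x0 (val p))) == x0).
Proof.
case: p => [p /= /andP[Pp /eqP lp]]; apply/andP; split.
  rewrite -{1}lp rev_path (eq_path (e' := edge)) //.
  by move=> x y; rewrite edge_sym.
by case: p {Pp} lp => //= y p _; rewrite rev_cons last_rcons.
Qed.

Definition loopV (p : edge_loop) : edge_loop :=
  Sub (rev (belast x0 (val p))) (loopV_subproof p).

Definition pi1_one : pi1 := (\pi_pi1 loop1)%qT.
Definition pi1_mul (a b : pi1) : pi1 := (\pi_pi1 (loopM (repr a) (repr b)))%qT.
Definition pi1_inv (a : pi1) : pi1 := (\pi_pi1 (loopV (repr a)))%qT.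

Lemma pi1_eqP (p q : edge_loop) :
  reflect (edge_homotopy (x0 :: val p) (x0 :: val q))
          ((\pi_pi1 p)%qT == (\pi_pi1 q)%qT).
Proof. by rewrite [_ == _]eqmodE; exact: asboolP. Qed.

Lemma loop_last (p : edge_loop) : last x0 (val p) = x0.
Proof. by case: p => p /= /andP[_ /eqP]. Qed.

Lemma loop_rcons (p : edge_loop) :
  x0 :: val p = rcons (belast x0 (val p)) x0.
Proof. by rewrite lastI loop_last. Qed.

Lemma loopM_homotopy (p p' q q' : edge_loop) :
  edge_homotopy (x0 :: val p) (x0 :: val p') ->
  edge_homotopy (x0 :: val q) (x0 :: val q') ->
  edge_homotopy (x0 :: val (loopM p q)) (x0 :: val (loopM p' q')).
Proof.
move=> pp' qq'; apply: (@rst_trans _ _ _ (x0 :: val p' ++ val q)).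
  exact: (edge_homotopy_cat [::] (val q) pp').
rewrite /= -!cat_cons loop_rcons !cat_rcons.
by have := edge_homotopy_cat (belast x0 (val p')) [::] qq'; rewrite !cats0.
Qed.

Lemma edge_homotopy_rev s t : edge_homotopy s t -> edge_homotopy (rev s) (rev t).
Proof.
elim=> [_ _ [{}s {}t x|{}s {}t x y z sxyz]|{}s|{}s {}t _ IH|{}s {}t u _ IH1 _ IH2].
- apply: rst_step; rewrite !rev_cat !rev_cons !cat_rcons; exact: EdgeStutter.
- apply: rst_step; rewrite !rev_cat !rev_cons !cat_rcons; apply: EdgeTriangle.
  by rewrite -fsetUA fsetUC (fsetUC [fset y]%fset).
- exact: rst_refl.
- exact: rst_sym.
- exact: rst_trans IH1 IH2.
Qed.

Lemma loopV_rev (p : edge_loop) : x0 :: val (loopV p) = rev (x0 :: val p).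
Proof. by rewrite [in RHS]loop_rcons rev_rcons. Qed.

Lemma path_revK (x : K) (s : seq K) : path edge x s ->
  edge_homotopy ((x :: s) ++ rev (belast x s)) [:: x].
Proof.
elim: s x => [|y s IH] x /=; first by move=> _; exact: rst_refl.
case/andP=> exy Ps; rewrite rev_cons -cats1 catA.
apply: (@rst_trans _ _ _ [:: x; y; x]).
  exact: (edge_homotopy_cat [:: x] [:: x] (IH y Ps)).
apply: (@rst_trans _ _ _ [:: x; x]); apply: rst_step.
  apply: (@EdgeTriangle [::] [::]).
  by rewrite fsetUC fsetUA fsetUid.
exact: (@EdgeStutter [::] [::]).
Qed.

Lemma pi1_mul_pi (p q : edge_loop) :
  pi1_mul (\pi_pi1 p)%qT (\pi_pi1 q)%qT = (\pi_pi1 (loopM p q))%qT.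
Proof.
by apply/eqP/pi1_eqP/loopM_homotopy; apply/pi1_eqP; rewrite reprK.
Qed.

Lemma pi1_inv_pi (p : edge_loop) :
  pi1_inv (\pi_pi1 p)%qT = (\pi_pi1 (loopV p))%qT.
Proof.
apply/eqP/pi1_eqP; rewrite !loopV_rev; apply/edge_homotopy_rev/pi1_eqP.
by rewrite reprK.
Qed.

Lemma pi1_mulA : associative pi1_mul.
Proof.
move=> a b c; rewrite -[a]reprK -[b]reprK -[c]reprK.
set p := repr a; set q := repr b; set r := repr c.
rewrite (pi1_mul_pi q r) (pi1_mul_pi p q) (pi1_mul_pi p) (pi1_mul_pi _ r).
have -> // : loopM p (loopM q r) = loopM (loopM p q) r.
by apply: val_inj; rewrite /= catA.
Qed.

Lemma pi1_mul1g : left_id pi1_one pi1_mul.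
Proof.
move=> a; rewrite -[a]reprK pi1_mul_pi.
have -> // : loopM loop1 (repr a) = repr a by apply: val_inj.
Qed.

Lemma pi1_mulg1 : right_id pi1_one pi1_mul.
Proof.
move=> a; rewrite -[a]reprK pi1_mul_pi.
have -> // : loopM (repr a) loop1 = repr a by apply: val_inj; rewrite /= cats0.
Qed.

Lemma pi1_mulgV : right_inverse pi1_one pi1_inv pi1_mul.
Proof.
move=> a; rewrite -[a]reprK pi1_inv_pi pi1_mul_pi; apply/eqP/pi1_eqP.
by apply: (@path_revK x0); case: (repr a) => s /= /andP[].
Qed.

Lemma pi1_mulVg : left_inverse pi1_one pi1_inv pi1_mul.
Proof.
move=> a; have := pi1_mulgV (pi1_inv a); have -> // : pi1_inv (pi1_inv a) = a.
rewrite -[a]reprK (pi1_inv_pi (repr a)) (pi1_inv_pi (loopV _)).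
have -> // : loopV (loopV (repr a)) = repr a.
apply: val_inj; suff [] : x0 :: val (loopV (loopV (repr a))) = x0 :: val (repr a) by [].
by rewrite !loopV_rev revK.
Qed.

HB.instance Definition _ := isGroup.Build pi1
  pi1_mulA pi1_mul1g pi1_mulg1 pi1_mulVg pi1_mulgV.

End EdgePaths.

Definition simply_connected (K : complex) : Prop :=
  connected_complex K /\ forall (x : K) (g : pi1 x), g = 1%g.

Definition universal_covering (U K : complex) (p : U -> K) : Prop :=
  simplicial_covering p /\ simply_connected U.

Definition common_universal_cover (K L : complex) : Prop :=
  exists (U V : complex) (p : U -> K) (q : V -> L),
    [/\ universal_covering p, universal_covering q & complex_iso U V].

Definition common_finite_cover (K L : complex) : Prop :=
  exists (Y : complex) (p : Y -> K) (q : Y -> L),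
    [/\ finite_complex Y, simplicial_covering p & simplicial_covering q].

(* [B] is a basis when every map from [B] to a group (given here by a total
   function, of which only the values on [B] matter) extends uniquely to a
   homomorphism. *)
Definition free_basis (G : groupType) (B : set G) : Prop :=
  forall (H : groupType) (f : G -> H),
    exists phi : {multiplicative G -> H},
      (forall b, B b -> phi b = f b) /\
      (forall psi : {multiplicative G -> H},
         (forall b, B b -> psi b = f b) -> psi =1 phi).

Definition free_group (G : groupType) : Prop :=
  exists B : set G, free_basis B.

Definition free_pi1 (K : complex) : Prop :=
  forall x : K, free_group (pi1 x).

(* Main.v *)
From HB Require Import structures.
From Stdlib Require Import Relation_Operators.
From mathcomp Require Import all_boot finmap perm.
From mathcomp Require Import boolp classical_sets functions cardinality.
Require Import Defs.

(* Let X cover X1 and X2 and be simply connected, and let G = pi1(X1), which is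
   free on B, act on X by deck transformations.  A G-invariant finite family of
   coverings X -> X2 would give a finite cover of X1 mapping to X2.  Instead one
   takes a family S representing all coverings X -> X2 up to agreement on a
   large finite connected D in X.  For D contained in D', two coverings which
   agree on D differ by an automorphism of X fixing D, so all restriction fibres
   from D' to D have the same size; comparing D and b^-1 D inside a common D'
   shows that f and f o b have the same distribution of restrictions to
   D n b^-1 D, as f runs through S.  Hence each b in B yields a permutation of S
   along which f o b and the image of f agree on D n b^-1 D.  As G is free, these
   permutations define an action of G on S, and the coverings in S glue to a
   covering (X x S)/G -> X2, provided D contains enough translates of the
   vertices of a fundamental domain. *)

Set Implicit Arguments.
Unset Strict Implicit.
Unset Printing Implicit Defensive.

Local Open Scope classical_set_scope.

Arguments edge {K}.

Local Notation vimage f s := [fset f u | u in s]%fset.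

(** * Maps that are bijective on stars *)

Definition star_bij (K L : complex) (f : K -> L) (v : K) : Prop :=
  set_bij (star v) (star (f v)) (fun s => vimage f s).

(** The covering condition on stars alone: simpliciality follows from it, and so does surjectivity
    onto a connected complex when the source has a vertex. *)
Definition local_iso (K L : complex) (f : K -> L) : Prop :=
  forall v, star_bij f v.

Lemma starP (K : complex) (v : K) (s : {fset K}) :
  star v s <-> simplex s /\ v \in s.
Proof. by split=> [/andP|] // [ss vs]; apply/andP. Qed.

Lemma simplex_mem (K : complex) (s : {fset K}) : simplex s ->
  exists v, v \in s.
Proof. by move/simplex_neq0/fset0Pn. Qed.

Lemma simplex_edge (K : complex) (s : {fset K}) (x y : K) :
  simplex s -> x \in s -> y \in s -> edge x y.
Proof.
move=> ss xs ys; apply: simplex_sub ss _ _.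
  by apply/fsubsetP => z; rewrite !inE => /orP[] /eqP->.
by apply/fset0Pn; exists x; rewrite !inE eqxx.
Qed.

Lemma simplicial_edge (K L : complex) (f : K -> L) (x y : K) :
  simplicial f -> edge x y -> edge (f x) (f y).
Proof. by move=> sf /sf; rewrite /edge imfset_fset2. Qed.

Lemma simplicial_path (K L : complex) (f : K -> L) (x : K) (s : seq K) :
  simplicial f -> path edge x s -> path edge (f x) (map f s).
Proof.
by move=> sf; elim: s x => //= y s IH x /andP[xy ys]; rewrite simplicial_edge ?IH.
Qed.

Lemma mem_vimage (K L : choiceType) (f : K -> L) (s : {fset K}) (x : K) :
  x \in s -> f x \in vimage f s.
Proof. by move=> xs; apply/imfsetP; exists x. Qed.

Lemma vimage_comp (K L M : choiceType) (f : K -> L) (g : L -> M)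
  (s : {fset K}) : vimage (g \o f) s = vimage g (vimage f s).
Proof.
apply/fsetP => z; apply/imfsetP/imfsetP => /= -[x].
  by move=> xs ->; exists (f x) => //; exact: mem_vimage.
by case/imfsetP => y /= ys -> ->; exists y.
Qed.

Lemma eq_vimage (K L : choiceType) (f g : K -> L) (s : {fset K}) :
  {in s, f =1 g} -> vimage f s = vimage g s.
Proof. by move=> fg; apply: eq_in_imfset. Qed.

Lemma local_iso_simplicial (K L : complex) (f : K -> L) :
  local_iso f -> simplicial f.
Proof.
move=> lf s ss; have [v vs] := simplex_mem ss.
by have [fs _ _] := lf v; have /starP[] := fs s (proj2 (starP v s) (conj ss vs)).
Qed.

Lemma star_bij_comp (K L M : complex) (f : K -> L) (g : L -> M) (v : K) :
  star_bij f v -> star_bij g (f v) -> star_bij (g \o f) v.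
Proof.
move=> bf bg; rewrite /star_bij.
have -> : (fun s : {fset K} => vimage (g \o f) s) =
  (fun s : {fset L} => vimage g s) \o (fun s : {fset K} => vimage f s).
  by apply: funext => s; rewrite /= (vimage_comp f g).
exact: set_bij_comp bf bg.
Qed.

Lemma star_bij_cancel_left (K L M : complex) (f : K -> L) (g : L -> M) (v : K) :
  star_bij f v -> star_bij (g \o f) v -> star_bij g (f v).
Proof.
move=> [ff fi fs] [hf hi hs]; split.
- by move=> t /fs[s sv <-]; have := hf s sv; rewrite (vimage_comp f g).
- move=> _ _ /set_mem/fs[s sv <-] /set_mem/fs[t tv <-].
  by rewrite -!(vimage_comp f g) => /hi -> //; apply/mem_set.
- move=> t /hs[s sv <-]; exists (vimage f s); first exact: ff.
  by rewrite (vimage_comp f g).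
Qed.

Lemma star_bij_cancel_right (K L M : complex) (f : K -> L) (g : L -> M) (v : K) :
  simplicial f -> star_bij g (f v) -> star_bij (g \o f) v -> star_bij f v.
Proof.
move=> sf [gf gi gs] [hf hi hs].
have ff s : star v s -> star (f v) (vimage f s).
  by move=> /starP[ss vs]; apply/starP; split; [exact: sf | exact: mem_vimage].
split; [exact: ff| |].
  by move=> s t sv tv e; apply: (hi s t sv tv); rewrite !(vimage_comp f g) e.
move=> t tv; have [s sv e] := hs _ (gf t tv); exists s; first exact: sv.
apply: (gi _ _ (mem_set (ff s sv)) (mem_set tv)).
by rewrite -(vimage_comp f g).
Qed.

Lemma eq_star_bij (K L : complex) (f g : K -> L) (v : K) :
  (forall w, edge v w -> f w = g w) -> star_bij f v -> star_bij g v.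
Proof.
move=> fg; have e s : star v s -> vimage f s = vimage g s.
  move=> /starP[ss vs]; apply: eq_vimage => w ws.
  exact/fg/(simplex_edge ss).
rewrite /star_bij -(fg v (edgexx v)).
by apply: eq_set_bijRL => s /set_mem/e.
Qed.

Lemma vimage_id (K : choiceType) (s : {fset K}) : vimage id s = s.
Proof.
by apply/fsetP => x; apply/imfsetP/idP => [[/= y ys ->]|xs] //; exists x.
Qed.

Lemma local_iso_id (K : complex) : local_iso (@id K).
Proof.
by move=> v; split=> [s|s t _ _|s vs]; rewrite ?vimage_id //; exists s; rewrite ?vimage_id.
Qed.

(** * Path lifting *)

Lemma rev_belastK (T : Type) (a : T) (s : seq T) :
  rev (belast (last a s) (rev (belast a s))) = s.
Proof.
have e (b : T) t : last b t :: rev (belast b t) = rev (b :: t).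
  by rewrite [in RHS]lastI rev_rcons.
have [_ ->] : last (last a s) (rev (belast a s)) ::
    rev (belast (last a s) (rev (belast a s))) = a :: s by rewrite !e revK.
by [].
Qed.

Section PathLifting.
Variables (K L : complex) (f : K -> L).

Lemma simplex_lift (v : K) (t : {fset L}) : star_bij f v ->
  simplex t -> f v \in t -> exists s, [/\ simplex s, v \in s & vimage f s = t].
Proof.
move=> [_ _ bs] st vt; have [s /starP[ss vs] e] := bs t (proj2 (starP _ _) (conj st vt)).
by exists s.
Qed.

(** Injectivity on stars is applied to the two edges as simplices. Since degenerate edges are
    allowed, the case [b = v] shows that no edge at [v] is collapsed. *)
Lemma edge_lift_inj (v a b : K) : star_bij f v ->
  edge v a -> edge v b -> f a = f b -> a = b.
Proof.
move=> [_ bi _] va vb e.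
have st c : edge v c -> star v [fset v; c]%fset.
  by move=> vc; apply/starP; split=> //; rewrite !inE eqxx.
have ei : vimage f [fset v; a]%fset = vimage f [fset v; b]%fset.
  by rewrite !imfset_fset2 e.
have := bi _ _ (mem_set (st a va)) (mem_set (st b vb)) ei.
move/fsetP => eab; have := eab a; have := eab b.
rewrite !inE !eqxx !orbT => /orP[/eqP bv|/eqP//].
by rewrite bv orbb => /esym/eqP.
Qed.

Lemma edge_lift (v : K) (w : L) : star_bij f v ->
  edge (f v) w -> exists2 v', edge v v' & f v' = w.
Proof.
move=> bv vw; have [|s [ss vs e]] := simplex_lift bv vw.
  by rewrite !inE eqxx.
have : w \in vimage f s by rewrite e !inE eqxx orbT.
by case/imfsetP => /= v' v's ->; exists v' => //; exact: simplex_edge ss vs v's.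
Qed.

(** Path lifting as a relation on end vertices, so that existence and uniqueness are separate
    statements. The path is given without its initial vertex [f y]; if that vertex is included, the
    lift along a local isomorphism merely starts with a degenerate edge. *)
Fixpoint lifts (y : K) (s : seq L) (z : K) : Prop :=
  if s is w :: s' then exists y', [/\ edge y y', f y' = w & lifts y' s' z]
  else y = z.

Lemma lifts_cat y s t z :
  lifts y (s ++ t) z <-> exists m, lifts y s m /\ lifts m t z.
Proof.
elim: s y => /= [|w s IH] y.
  by split=> [yz|[m [-> //]]]; exists y.
split=> [[y' [yy' e /IH[m [sm mt]]]]|[m [[y' [yy' e sm]] mt]]].
  by exists m; split=> //; exists y'.
by exists y'; split=> //; apply/IH; exists m.
Qed.

Lemma lifts_last y s z : lifts y s z -> f z = last (f y) s.
Proof. by elim: s y => /= [|w s IH] y; [move-> | case=> y' [_ <- /IH]]. Qed.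

Lemma lifts_image y s : path edge y s -> simplicial f ->
  lifts y (map f s) (last y s).
Proof.
move=> ps sf; elim: s y ps => //= w s IH y /andP[yw ws].
by exists w; split=> //; exact: IH.
Qed.

Lemma lifts_path y s z : lifts y s z ->
  exists t, [/\ path edge y t, last y t = z & map f t = s].
Proof.
elim: s y => /= [y ->|w s IH y [y' [yy' e /IH[t [pt lt mt]]]]]; first by exists [::].
by exists (y' :: t); rewrite /= yy' pt lt mt e.
Qed.

Lemma lifts_rev y s z : lifts y s z -> lifts z (rev (belast (f y) s)) y.
Proof.
elim: s y => /= [y ->//|w s IH y [y' [yy' e /IH]]].
rewrite rev_cons -cats1 e => zy'; apply/lifts_cat; exists y'; split=> //=.
by exists y; rewrite edge_sym.
Qed.

Lemma lifts_revK y s z : f z = last (f y) s ->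
  lifts z (rev (belast (f y) s)) y -> lifts y s z.
Proof. by move=> ez /lifts_rev; rewrite ez rev_belastK. Qed.

Hypothesis f_iso : local_iso f.

Lemma lifts_fun y s z z' : lifts y s z -> lifts y s z' -> z = z'.
Proof.
elim: s y => /= [y <-//|w s IH y [a [ya ea az]] [b [yb eb bz]]].
apply: IH az _; suff -> : a = b by [].
by apply: edge_lift_inj (f_iso y) ya yb _; rewrite ea.
Qed.

Lemma lifts_total y s : path edge (f y) s -> exists z, lifts y s z.
Proof.
elim: s y => /= [y _|w s IH y /andP[yw ws]]; first by exists y.
have [y' yy' e] := edge_lift (f_iso y) yw.
by rewrite -e in ws; have [z y'z] := IH _ ws; exists z, y'.
Qed.

(** It suffices to treat one move. A stutter lifts to a degenerate edge; for a triangle, the simplex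
    is lifted at the vertex over [a], and uniqueness of edge lifts places the lifted path inside
    that simplex. *)
Lemma lifts_homotopy s t y z : edge_homotopy s t -> lifts y s z <-> lifts y t z.
Proof.
move=> st; elim: st y z => {s t}.
- move=> _ _ [s t x|s t a b c abc] y z; rewrite !lifts_cat.
    split=> -[m [sm mt]]; exists m; split=> //.
      case: mt => x1 [mx1 e1 [x2 [x12 e2 x2t]]]; exists x2; split=> //.
      by rewrite (edge_lift_inj (f_iso x1) x12 (edgexx x1)) ?e1.
    by case: mt => x1 [mx1 e1 x1t]; exists x1; split=> //; exists x1; rewrite edgexx.
  have lift_abc a' : f a' = a -> exists u, [/\ simplex u, a' \in u &
      vimage f u = [fset a; b; c]%fset].
    by move=> e; apply: simplex_lift (f_iso a') abc _; rewrite e !inE eqxx.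
  split=> -[m [sm mt]]; exists m; split=> //.
    case: mt => a' [ma ea [b' [ab eb [c' [bc ec ct]]]]]; exists a'; split=> //.
    exists c'; split=> //; have [u [su au eu]] := lift_abc a' ea.
    have find d : d \in [fset a; b; c]%fset -> exists2 d', d' \in u & f d' = d.
      by rewrite -eu => /imfsetP[d' /= du ->]; exists d'.
    have [|b1 b1u eb1] := find b; first by rewrite !inE eqxx orbT.
    have [|c1 c1u ec1] := find c; first by rewrite !inE eqxx orbT.
    have e1 : b' = b1.
      by apply: edge_lift_inj (f_iso a') ab (simplex_edge su au b1u) _; rewrite eb.
    rewrite -e1 in b1u.
    have -> : c' = c1.
      by apply: edge_lift_inj (f_iso b') bc (simplex_edge su b1u c1u) _; rewrite ec.
    exact: simplex_edge su au c1u.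
  case: mt => a' [ma ea [c' [ac ec ct]]]; exists a'; split=> //.
  have [u [su au eu]] := lift_abc a' ea.
  have find d : d \in [fset a; b; c]%fset -> exists2 d', d' \in u & f d' = d.
    by rewrite -eu => /imfsetP[d' /= du ->]; exists d'.
  have [|b1 b1u eb1] := find b; first by rewrite !inE eqxx orbT.
  have [|c1 c1u ec1] := find c; first by rewrite !inE eqxx orbT.
  exists b1; split=> //; first exact: simplex_edge su au b1u.
  exists c'; split=> //; have -> : c' = c1.
    by apply: edge_lift_inj (f_iso a') ac (simplex_edge su au c1u) _; rewrite ec.
  exact: simplex_edge su b1u c1u.
- by [].
- by move=> s t _ IH y z; rewrite IH.
- by move=> s t u _ IH1 _ IH2 y z; rewrite IH1.
Qed.

Lemma lifts_loop s y z : edge_homotopy (f y :: s) [:: f y] -> lifts y s z -> y = z.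
Proof.
move=> h ysz; have : lifts y (f y :: s) z by exists y; rewrite edgexx.
move/(lifts_homotopy y z h) => /= [y' [yy' e <-]].
by apply: edge_lift_inj (f_iso y) (edgexx y) yy' _; rewrite e.
Qed.

Lemma local_iso_surj (v : K) : connected_complex L -> forall w, exists v', f v' = w.
Proof.
move=> [_ cL] w; have [s ps <-] := cL (f v) w.
by have [z /lifts_last ez] := lifts_total ps; exists z.
Qed.

End PathLifting.

(** Agreement after [q] is asked only along the path, so that the lemma applies to maps compared on
    a finite set of vertices. *)
Lemma unique_lift_path (X K L : complex) (q : K -> L) (f g : X -> K)
    (x : X) (s : seq X) :
  local_iso q -> simplicial f -> simplicial g -> f x = g x ->
  path edge x s -> {in s, forall y, q (f y) = q (g y)} ->
  f (last x s) = g (last x s).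
Proof.
move=> qi sf sg; elim: s x => //= y s IH x e /andP[xy ps] qs.
apply: IH => // [|z zs]; last by apply: qs; rewrite inE zs orbT.
apply: edge_lift_inj (qi (f x)) (simplicial_edge sf xy) _ _; last first.
  by apply: qs; rewrite mem_head.
by rewrite e; exact: simplicial_edge sg xy.
Qed.

Lemma unique_lift (X K L : complex) (q : K -> L) (f g : X -> K) (x : X) :
  local_iso q -> connected_complex X -> simplicial f -> simplicial g ->
  f x = g x -> q \o f =1 q \o g -> f =1 g.
Proof.
move=> qi [_ cX] sf sg e qfg y; have [s ps <-] := cX x y.
by apply: unique_lift_path qi sf sg e ps _ => z _; exact: qfg.
Qed.

Lemma simplicial_homotopy (K L : complex) (f : K -> L) (s t : seq K) :
  simplicial f -> edge_homotopy s t -> edge_homotopy (map f s) (map f t).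
Proof.
move=> sf; elim=> {s t} [_ _ [s t x|s t x y z /sf sxyz]|s|s t _ IH|s t u _ IH1 _ IH2].
- by apply: rst_step; rewrite !map_cat /=; exact: EdgeStutter.
- apply: rst_step; rewrite !map_cat /=; apply: EdgeTriangle.
  by move: sxyz; rewrite imfsetU imfset_fset2 imfset_fset1.
- exact: rst_refl.
- exact: rst_sym.
- exact: rst_trans IH1 IH2.
Qed.

Lemma simply_connected_loop (K : complex) (x : K) (s : seq K) :
  simply_connected K -> path edge x s -> last x s = x ->
  edge_homotopy (x :: s) [:: x].
Proof.
move=> [_ tK] ps ls.
have sP : path edge x s && (last x s == x) by rewrite ps ls eqxx.
pose l : edge_loop x := exist _ s sP.
by have /eqP/pi1_eqP := etrans (tK x (\pi_(pi1 x) l)%qT) (esym (tK x (\pi_(pi1 x) (loop1 x))%qT)).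
Qed.

(** * The lifting criterion for simply connected complexes *)

Section Lifting.
Variables (X K L : complex) (r : X -> L) (q : K -> L) (x : X) (z : K).
Hypotheses (scX : simply_connected X) (r_iso : local_iso r) (q_iso : local_iso q).
Hypothesis (rx : r x = q z).

Let sr := local_iso_simplicial r_iso.

Definition lift_to (y : X) (e : K) : Prop :=
  exists s, [/\ path edge x s, last x s = y & lifts q z (map r s) e].

Lemma lift_to_total y : exists e, lift_to y e.
Proof.
have [_ /(_ x y)[s ps ls]] := scX.1.
have [|e le] := @lifts_total _ _ _ q_iso z (map r s).
  by rewrite -rx simplicial_path.
by exists e, s.
Qed.

(** Two paths from [x] to [y] form a loop, which is null-homotopic in [X]; hence its image under [r]
    lifts from [z] to a closed path, and the lifts of the two images end at the same vertex. *)
Lemma lift_to_fun y e e' : lift_to y e -> lift_to y e' -> e = e'.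
Proof.
move=> [s [ps ls le]] [s' [ps' ls' le']].
have [b] : exists b, lifts q e (rev (belast (q z) (map r s'))) b.
  apply: (lifts_total q_iso); rewrite (lifts_last le) -rx.
  have -> : last (r x) (map r s) = last (r x) (map r s').
    by rewrite !last_map ls ls'.
  rewrite rev_path (eq_path (e' := edge)) ?simplicial_path // => a c.
  by rewrite edge_sym.
move=> eb; have : z = b.
  apply: (lifts_loop q_iso (s := map r s ++ rev (belast (q z) (map r s')))).
    rewrite -rx.
    have -> : r x :: map r s ++ rev (belast (r x) (map r s')) =
        map r (x :: s ++ rev (belast x s')).
      by rewrite /= map_cat map_rev; congr (_ :: _ ++ rev _); elim: (s') (x) => //= a l IH c; rewrite IH.
    apply: (simplicial_homotopy sr (t := [:: x])).
    have lr : last y (rev (belast x s')) = x.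
      by case: (s') ls' => [/= <-//|a l _]; rewrite /= rev_cons last_rcons.
    apply: simply_connected_loop => //; last by rewrite last_cat ls.
    rewrite cat_path ps ls -ls' rev_path (eq_path (e' := edge)) // => a c.
    by rewrite edge_sym.
  by apply/lifts_cat; exists e.
move=> zb; rewrite -zb in eb.
apply: (lifts_fun q_iso (y := z) (s := map r s')); last exact: le'.
apply: lifts_revK eb.
by rewrite (lifts_last le) -rx !last_map ls ls'.
Qed.

Theorem lifting : exists u : X -> K, [/\ local_iso u, u x = z & q \o u =1 r].
Proof.
have [u uP] := choice lift_to_total.
have u_edge y y' : edge y y' -> edge (u y) (u y').
  have [s [ps ls le]] := uP y => yy'.
  (* The path to [y] extended by [y'] has an image whose lift ends at the neighbour [e'] of [u y],
     so well-definedness forces [u y' = e']. *)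
  have [|e' ee e'y'] := @edge_lift _ _ q (u y) (r y') (q_iso _).
    by rewrite (lifts_last le) -rx last_map ls simplicial_edge.
  suff -> : u y' = e' by [].
  apply: lift_to_fun (uP y') _; exists (rcons s y'); split.
  - by rewrite rcons_path ps ls.
  - by rewrite last_rcons.
  - by rewrite map_rcons -cats1; apply/lifts_cat; exists (u y); split=> //; exists e'.
have qu y : q (u y) = r y.
  by have [s [ps ls le]] := uP y; rewrite (lifts_last le) -rx last_map ls.
have su : simplicial u.
  move=> s ss; have [y ys] := simplex_mem ss.
  have [t [st yt et]] : exists t, [/\ simplex t, u y \in t & vimage q t = vimage r s].
    by apply: simplex_lift (q_iso _) (sr ss) _; rewrite qu mem_vimage.
  apply: (simplex_sub st); last by apply/fset0Pn; exists (u y); exact: mem_vimage.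
  apply/fsubsetP => _ /imfsetP[y' /= y's ->].
  have : r y' \in vimage q t by rewrite et mem_vimage.
  case/imfsetP => b /= bt eb; suff -> : u y' = b by [].
  apply: edge_lift_inj (q_iso (u y)) (u_edge _ _ (simplex_edge ss ys y's)) _ _.
    exact: simplex_edge st yt bt.
  by rewrite qu.
have qur : q \o u = r by apply: funext => y; exact: qu.
exists u; split=> //.
  by move=> y; apply: star_bij_cancel_right su (q_iso _) _; rewrite qur.
by apply: lift_to_fun (uP x) _; exists [::].
Qed.
End Lifting.

(** * Deck transformations *)

Record deck_action (X K : complex) (p : X -> K) (G : groupType)
    (rho : G -> X -> X) : Prop := DeckAction {
  deck_iso : forall g, local_iso (rho g);
  deck_proj : forall g y, p (rho g y) = p y;
  deck1 : forall y, rho 1%g y = y;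
  deckM : forall g h y, rho (g * h)%g y = rho g (rho h y);
  deck_free : forall g y, rho g y = y -> g = 1%g;
  deck_trans : forall y z, p y = p z -> exists g, rho g y = z
}.

Section Monodromy.
Variables (X K : complex) (p : X -> K) (x : X).
Hypotheses (scX : simply_connected X) (p_iso : local_iso p).

Lemma lifts_homotopic s s' z z' : edge_homotopy (p x :: s) (p x :: s') ->
  lifts p x s z -> lifts p x s' z' -> z = z'.
Proof.
move=> h xz xz'; apply: (lifts_fun p_iso (y := x) (s := p x :: s')); last first.
  by exists x; rewrite edgexx.
by apply/(lifts_homotopy p_iso _ _ h); exists x; rewrite edgexx.
Qed.

Lemma lifts_deck (u : X -> X) y s z : simplicial u -> p \o u =1 p ->
  lifts p y s z -> lifts p (u y) s (u z).
Proof.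
move=> su pu; elim: s y => /= [y ->//|w s IH y [y' [yy' e y'z]]].
by exists (u y'); split; [exact: simplicial_edge | rewrite [LHS]pu | exact: IH].
Qed.

(** The class [g] acts by the deck transformation that moves [x] to the end of the lift of a loop
    representing [g]. A deck transformation is determined by its value at [x], so the unit and
    product laws are checked there. *)
Lemma monodromy_action :
  exists rho : pi1 (p x) -> X -> X, deck_action p rho.
Proof.
have exu (g : pi1 (p x)) : exists u : X -> X,
    [/\ local_iso u, p \o u =1 p & lifts p x (val (repr g)) (u x)].
  have /andP[pg /eqP lg] := valP (repr g).
  have [z xz] := lifts_total p_iso pg.
  have [|u [u_iso ux pu]] := @lifting _ _ _ p p x z scX p_iso p_iso.
    by rewrite (lifts_last xz) lg.
  by exists u; rewrite ux.
have [rho rhoP] := choice exu.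
have rho_iso g : local_iso (rho g) by case: (rhoP g).
have rho_simp g := local_iso_simplicial (rho_iso g).
have rho_proj g y : p (rho g y) = p y by have [_ /(_ y) pu _] := rhoP g; rewrite -[RHS]pu.
have rho_lifts g l z : g = (\pi_(pi1 (p x)) l)%qT -> lifts p x (val l) z -> rho g x = z.
  move=> eg xz; have [_ _ xg] := rhoP g; apply: lifts_homotopic xg xz.
  by apply/pi1_eqP; rewrite reprK eg.
have rho_eq (u v : X -> X) : local_iso u -> local_iso v -> p \o u =1 p ->
    p \o v =1 p -> u x = v x -> u =1 v.
  move=> ui vi pu pv uvx; apply: unique_lift p_iso scX.1 _ _ uvx _.
  - exact: local_iso_simplicial.
  - exact: local_iso_simplicial.
  - by move=> y; rewrite pu pv.
have id_iso : local_iso (@id X) := @local_iso_id X.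
exists rho.
have rho1 : rho 1%g =1 id.
  apply: (rho_eq _ _ (rho_iso _) id_iso (rho_proj _)) => //.
  exact: (rho_lifts _ (loop1 (p x))).
have rhoM g h y : rho (g * h)%g y = rho g (rho h y).
  move: y; apply: (rho_eq _ (rho g \o rho h) (rho_iso _) _ (rho_proj _)).
  - by move=> y; apply: star_bij_comp (rho_iso _ _) (rho_iso _ _).
  - by move=> y /=; rewrite !rho_proj.
  apply: (rho_lifts _ (loopM (repr g) (repr h))) => //=.
  have [_ _ xg] := rhoP g; have [_ _ xh] := rhoP h.
  (* The lift of the product is the lift for [g] followed by the [rho g]-translate of the lift for
     [h]. *)
  by apply/lifts_cat; exists (rho g x); split=> //; exact: lifts_deck (rho_simp g) (rho_proj g) xh.
split=> // [g y gy|y z yz].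
  have gx : rho g x = x.
    apply: (unique_lift (q := p) (f := rho g) (g := id) (x := y)) => //.
    - exact: scX.1.
    - exact: local_iso_simplicial.
    - by move=> w; rewrite /= rho_proj.
  (* As [rho g] fixes [x], the loop of [g] lifts to a loop of [X], whose null-homotopy projects to
     [K]. *)
  have [_ _ ] := rhoP g; rewrite gx => /lifts_path[t [pt lt et]].
  rewrite -[g]reprK; apply/eqP/pi1_eqP => /=; rewrite -et.
  apply: (simplicial_homotopy (s := x :: t) (t := [:: x])).
    exact: local_iso_simplicial.
  exact: simply_connected_loop.
have [u [u_iso uy pu]] := @lifting _ _ _ p p y z scX p_iso p_iso yz.
have [_ /(_ x (u x))[s ps ls]] := scX.1.
have lP : path edge (p x) (map p s) && (last (p x) (map p s) == p x).
  rewrite simplicial_path //; last exact: local_iso_simplicial.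
  by rewrite last_map ls [p (u x)]pu eqxx.
pose l : edge_loop (p x) := exist _ (map p s) lP.
exists (\pi_(pi1 (p x)) l)%qT; rewrite -uy.
apply: (rho_eq _ _ (rho_iso _) u_iso (rho_proj _) pu).
apply: (rho_lifts _ l) => //=; rewrite -ls; apply: lifts_image => //.
exact: local_iso_simplicial.
Qed.

End Monodromy.

(** * Words in a free basis *)

Section Generated.
Variables (G : groupType) (B : set G).

Definition letter (c : G) : Prop := B c \/ B c^-1%g.

Definition word (w : seq G) : Prop := {in w, forall c, letter c}.

Definition wprod (w : seq G) : G := foldr (fun a b => (a * b)%g) 1%g w.

Lemma wprod_cat v w : wprod (v ++ w) = (wprod v * wprod w)%g.
Proof. by elim: v => [|a v IH] /=; rewrite ?mul1g // IH mulgA. Qed.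

Lemma wprod_rev w : wprod (rev [seq c^-1%g | c <- w]) = (wprod w)^-1%g.
Proof.
elim: w => [|a w IH] /=; first by rewrite invg1.
by rewrite rev_cons -cats1 wprod_cat IH /= mulg1 invgM.
Qed.

Definition generated : pred G :=
  fun g => `[< exists2 w, word w & g = wprod w >].

Lemma generated_closed : group_closed generated.
Proof.
split; first by apply/asboolP; exists [::].
move=> _ _ /asboolP[v vB ->] /asboolP[w wB ->]; apply/asboolP.
exists (v ++ rev [seq c^-1%g | c <- w]); last by rewrite wprod_cat wprod_rev.
move=> c; rewrite mem_cat mem_rev => /orP[/vB//|/mapP[d /wB dB ->]].
by case: dB => dB; [right; rewrite invgK | left].
Qed.

Definition subgroup : Type := {g : G | generated g}.
HB.instance Definition _ := SubChoice.on subgroup.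
HB.instance Definition _ :=
  SubChoice_isSubGroup.Build G generated subgroup generated_closed.

(* The retraction of [G] onto the subgroup generated by [B], provided by the
   universal property, is the identity by uniqueness of extensions. *)
Lemma free_basis_generates : free_basis B ->
  forall g, exists2 w, word w & g = wprod w.
Proof.
move=> freeB.
have BG b : B b -> generated b.
  move=> Bb; apply/asboolP; exists [:: b]; last by rewrite /= mulg1.
  by move=> c; rewrite inE => /eqP->; left.
(* The default value [1] of [insubd] is never taken on [B], by [BG]. *)
have [phi [phiB _]] := freeB subgroup (fun g => insubd 1%g g).
have [psi [_ psiU]] := freeB G id.
move=> g; apply/asboolP.
have -> : g = val (phi g).
  transitivity (psi g); first by apply: (psiU idfun).
  apply/esym; apply: (psiU (val \o phi)) => b Bb.
  by rewrite /= phiB // insubdK //; exact: BG.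
exact: (valP (phi g)).
Qed.

End Generated.

(** * Transversals of the coverings modulo agreement on a finite set *)

Lemma finite_complex_vertices (K : complex) : finite_complex K ->
  exists V : {fset K}, forall v, v \in V.
Proof.
move=> /finite_fsetP[B eB]; exists (\bigcup_(s <- B) s)%fset => v.
apply/bigfcupP; exists [fset v]%fset; rewrite ?inE ?eqxx // andbT.
by have : [set` B] [fset v]%fset; first by rewrite -eB; exact: simplex_vertex.
Qed.

(** Equal fibre sizes mean that the lists of values of [a] and [b] have the same multiplicities,
    hence differ by a permutation of positions, which the enumeration of [S] carries over to [S]. *)
Lemma matching_perm (S : finType) (T : eqType) (a b : S -> T) :
  (forall t, #|[pred s | a s == t]| = #|[pred s | b s == t]|) ->
  exists sigma : {perm S}, forall s, b (sigma s) = a s.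
Proof.
move=> ab.
have countE (f : S -> T) t : count_mem t (codom f) = #|[pred s | f s == t]|.
  rewrite codomE count_map -size_filter cardE [in RHS]/enum_mem -enumT.
  by congr size; apply: eq_filter => s.
have /tuple_permP[p ep] : perm_eq (codom_tuple a) (codom_tuple b).
  by apply/allP => t _ /=; rewrite !countE ab.
have inj : injective (fun s => enum_val (p (enum_rank s))).
  by move=> s t /enum_val_inj/perm_inj/enum_rank_inj.
exists (perm inj) => s; rewrite permE.
have := congr1 (fun u => nth (a s) u (enum_rank s)) ep.
rewrite nth_codom enum_rankK => ->.
rewrite -[RHS](tnth_nth (a s) [tuple tnth (codom_tuple b) (p i) | i < #|S|]).
by rewrite tnth_mktuple (tnth_nth (a s)) /= nth_codom.
Qed.

Lemma card_constant_fibres (S S' : finType) (T : eqType) (pi : S' -> S)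
    (a : S -> T) (c : nat) (t : T) :
  (forall s, #|[pred j | pi j == s]| = c) ->
  #|[pred j | a (pi j) == t]| = #|[pred s | a s == t]| * c.
Proof.
move=> fib; rewrite -sum1_card (partition_big pi (fun s => a s == t)) //=.
rewrite -sum_nat_const; apply: eq_bigr => s /eqP as_t.
rewrite -(fib s) -sum1_card; apply: eq_bigl => j; rewrite !inE.
by case: (pi j =P s) => [->|_]; rewrite ?andbF // as_t eqxx.
Qed.

Definition connected_in (X : complex) (K : seq X) : Prop :=
  forall x y, x \in K -> y \in K ->
    exists s, [/\ path edge x s, last x s = y & {subset s <= K}].

(** The set is the union of chosen paths from one root to the elements of [D]; any two of its
    vertices are joined through the root along initial segments of these paths. *)
Lemma connected_superset (X : complex) (D : seq X) : connected_complex X ->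
  exists K, connected_in K /\ {subset D <= K}.
Proof.
move=> [[x _] cX].
have /choice[g gP] y : exists s, path edge x s /\ last x s = y.
  by have [s ps ls] := cX x y; exists s.
exists (flatten [seq x :: g y | y <- D]); split; last first.
  move=> y yD; apply/flattenP; exists (x :: g y); first exact: map_f.
  by have [_ {1}<-] := gP y; exact: mem_last.
set K := flatten _.
have root y : y \in K -> exists s, [/\ path edge x s, last x s = y & {subset x :: s <= K}].
  case/flattenP => _ /mapP[z zD ->] yz; have [pz _] := gP z.
  have [s [t [est ls]]] : exists s t, g z = s ++ t /\ last x s = y.
    by case/splitPl: yz => s t ls; exists s, t.
  move: pz; rewrite est cat_path => /andP[ps _].
  exists s; split=> // w ws; apply/flattenP; exists (x :: g z); first exact: map_f.
  by rewrite est -cat_cons mem_cat ws.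
move=> y z /root[s [ps ls sK]] /root[t [pt lt tK]].
exists (rev (belast x s) ++ t).
have lr : last y (rev (belast x s)) = x.
  by case: (s) ls => [/= <-//|a l _]; rewrite /= rev_cons last_rcons.
split.
- rewrite cat_path lr pt andbT -ls rev_path (eq_path (e' := edge)) // => a c.
  by rewrite edge_sym.
- by rewrite last_cat lr.
move=> w; rewrite mem_cat mem_rev => /orP[/mem_belast/sK //|wt].
by apply: tK; rewrite inE wt orbT.
Qed.

(** One representative for each class of local isomorphisms under agreement on the finite vertex
    list [K]. *)
Record transversal (X L : complex) (K : seq X) (S : finType)
    (r : S -> X -> L) : Prop := Transversal {
  transversal_iso : forall s, local_iso (r s);
  transversal_inj : forall s t, {in K, r s =1 r t} -> s = t;
  transversal_ex : forall f, local_iso f -> exists s, {in K, r s =1 f}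
}.

(** A class is determined by its tuple of values on [K], and the vertex set of [L] is finite; [S]
    consists of the tuples that some local isomorphism realizes. *)
Lemma exists_transversal (X L : complex) (K : seq X) : finite_complex L ->
  exists (S : finType) (r : S -> X -> L), transversal K r.
Proof.
move=> /finite_complex_vertices[V VP].
pose germ := [pred t : (size K).-tuple V |
  `[< exists f : X -> L, local_iso f /\ map f K = map val t >]].
have rP (s : {t | germ t}) : exists f : X -> L, local_iso f /\ map f K = map val (val s).
  by apply/asboolP; exact: valP s.
have [r rE] := choice rP.
exists {t | germ t}, r; split=> [s|s t|f f_iso].
- by have [] := rE s.
- have [[_ es] [_ et]] := (rE s, rE t).
  move/eq_in_map; rewrite es et => e; apply/val_inj/val_inj.
  by apply: inj_map e; exact: val_inj.
have sz : size (map (fun y => [` VP (f y)]%fset) K) == size K by rewrite size_map.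
pose t : (size K).-tuple V := Tuple sz.
have et : map f K = map val t by rewrite /= -map_comp.
have tP : germ t by apply/asboolP; exists f.
exists (exist _ t tP); apply/eq_in_map.
by have [_ ->] := rE (exist _ t tP); rewrite et.
Qed.

(** * Counting the extensions from one finite set to a larger one *)

Section Fibres.
Variables (X L : complex) (K K' : seq X) (x : X).
Variables (S S' : finType) (r : S -> X -> L) (r' : S' -> X -> L).
Hypotheses (scX : simply_connected X) (cK : connected_in K)
  (cK' : connected_in K') (xK : x \in K) (KK' : {subset K <= K'}).
Hypotheses (rT : transversal K r) (rT' : transversal K' r').

Let r_iso := transversal_iso rT.
Let r'_iso := transversal_iso rT'.

(* Two maps which agree on [K] differ by an automorphism [u] fixing [K], and
   composition with [u] transfers an extension from one fibre to another. *)
Lemma fibre_leq s t : #|[pred j | map (r' j) K == map (r s) K]| <=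
  #|[pred j | map (r' j) K == map (r t) K]|.
Proof.
set A := [pred j | _ == map (r s) K].
have /choice[h hP] j : exists j', j \in A -> exists u,
    [/\ local_iso u, u x = x, {in K, u =1 id}, r s \o u =1 r' j &
        {in K', r' j' =1 r t \o u}].
  have [jA|nA] := pselect (j \in A); last by exists j => /nA.
  have /eq_in_map jK : map (r' j) K = map (r s) K by apply/eqP; rewrite inE in jA.
  have [u [u_iso ux su]] := @lifting _ _ _ (r' j) (r s) x x scX
    (r'_iso j) (r_iso s) (jK x xK).
  have [|j' j'P] := transversal_ex rT' (f := r t \o u).
    by move=> y; apply: star_bij_comp (u_iso _) (r_iso t _).
  exists j' => _; exists u; split=> // y yK.
  have [w [pw <- wK]] := cK xK yK.
  apply: (unique_lift_path (r_iso s) (local_iso_simplicial u_iso)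
    (local_iso_simplicial (@local_iso_id X)) ux pw) => z /wK zK.
  by rewrite [LHS]su jK.
have hA : {in A, forall j, h j \in [pred j | map (r' j) K == map (r t) K]}.
  move=> j /hP[u [_ _ uK _ hj]]; rewrite inE; apply/eqP/eq_in_map => y yK.
  by rewrite hj ?KK' //= uK.
have h_inj : {in A &, injective h}.
  (* If [j1] and [j2] have the same image, then [u1] and [u2] agree at [x] and, after composition
     with [r t], on [K']; as [K'] is connected, they agree on [K']. *)
  move=> j1 j2 /hP[u1 [i1 x1 _ s1 h1]] /hP[u2 [i2 x2 _ s2 h2]] e.
  apply: (transversal_inj rT') => y yK'; rewrite -s1 -s2 /=; congr (r s _).
  have [w [pw <- wK']] := cK' (KK' xK) yK'.
  apply: (unique_lift_path (r_iso t) (local_iso_simplicial i1)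
    (local_iso_simplicial i2) _ pw) => [|z /wK' zK']; first by rewrite x1 x2.
  by rewrite -[LHS]h1 // e h2.
rewrite -(card_in_imset h_inj); apply: subset_leq_card.
by apply/fintype.subsetP => _ /imsetP[j jA ->]; exact: hA.
Qed.

(** The factor [c] is the common fibre size of restriction from [S'] to [S]. The invariant [a] is
    left general in order to cover both restrictions to a subset of [K] and the constant invariant,
    which counts everything. *)
Lemma card_extensions : exists c, forall (T : eqType) (a : (X -> L) -> T) t,
  (forall f g, {in K, f =1 g} -> a f = a g) ->
  #|[pred j | a (r' j) == t]| = #|[pred s | a (r s) == t]| * c.
Proof.
have [s0|S0] := pickP S; last first.
  exists 0 => T a t _; rewrite muln0; apply: eq_card0 => j.
  by have [s] := transversal_ex rT (r'_iso j); have := S0 s.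
exists #|[pred j | map (r' j) K == map (r s0) K]| => T a t aK.
have /choice[pi piP] j : exists s, {in K, r s =1 r' j} := transversal_ex rT (r'_iso j).
rewrite -(card_constant_fibres (pi := pi) (a \o r) t) => [|s].
  by apply: eq_card => j; rewrite !inE /= (aK _ _ (piP j)).
transitivity #|[pred j | map (r' j) K == map (r s) K]|; last first.
  by apply/eqP; rewrite eqn_leq !fibre_leq.
apply: eq_card => j; rewrite !inE.
apply/eqP/eqP => [<-|/eq_in_map e].
  by apply/esym/eq_in_map; exact: piP.
by apply: (transversal_inj rT) => y yK; rewrite piP // e.
Qed.

End Fibres.

Lemma transversal_perm (X L : complex) (K : seq X) (x : X) (S : finType)
    (r : S -> X -> L) (u v : X -> X) :
  simply_connected X -> finite_complex L -> connected_in K -> x \in K ->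
  transversal K r -> local_iso u -> local_iso v -> cancel u v -> cancel v u ->
  exists sigma : {perm S}, forall s y, y \in K -> u y \in K ->
    r (sigma s) y = r s (u y).
Proof.
move=> scX finL cK xK rT u_iso v_iso uK vK.
have [s0 _|S0] := pickP S; last by exists 1%g => s; have := S0 s.
(* Composition with [u] turns the transversal for [K] into one for its preimage [K1], with the same
   index set. *)
pose K1 := map v K; pose r1 s := r s \o u.
have rT1 : transversal K1 r1.
  split=> [s y|s t st|f f_iso].
  - exact: star_bij_comp (u_iso y) (transversal_iso rT s _).
  - apply: (transversal_inj rT) => y yK.
    by have := st (v y) (map_f v yK); rewrite /r1 /= vK.
  have [|s sP] := transversal_ex rT (f := f \o v).
    by move=> y; apply: star_bij_comp (v_iso y) (f_iso _).
  by exists s => _ /mapP[y yK ->]; rewrite /r1 /= vK sP.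
have cK1 : connected_in K1.
  move=> _ _ /mapP[y yK ->] /mapP[z zK ->]; have [w [pw <- wK]] := cK y z yK zK.
  exists (map v w); split; first exact: simplicial_path (local_iso_simplicial v_iso) pw.
    by rewrite last_map.
  by move=> _ /mapP[b /wK bK ->]; exact: map_f.
have [K' [cK' KK']] := connected_superset (K ++ K1) scX.1.
have [S' [r' rT']] := exists_transversal K' finL.
have sub : {subset K <= K'} by move=> y yK; apply: KK'; rewrite mem_cat yK.
have sub1 : {subset K1 <= K'} by move=> y yK; apply: KK'; rewrite mem_cat yK orbT.
have [c cP] := card_extensions scX cK cK' xK sub rT rT'.
have [c1 c1P] := card_extensions scX cK1 cK' (map_f v xK) sub1 rT1 rT'.
(* As a set, [E] is the intersection of [K] and [K1], so restriction to [E] is an invariant for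
   both. *)
pose E := [seq y <- K | u y \in K].
have EK f g : {in K, f =1 g} -> map f E = map g E.
  by move=> fg; apply/eq_in_map => y; rewrite mem_filter => /andP[_ /fg].
have EK1 f g : {in K1, f =1 g} -> map f E = map g E.
  move=> fg; apply/eq_in_map => y; rewrite mem_filter => /andP[uyK _].
  by rewrite -[y]uK; apply: fg; exact: map_f.
have [sigma sigmaP] : exists sigma : {perm S}, forall s,
    map (r (sigma s)) E = map (r1 s) E.
  apply: (@matching_perm _ _ (fun s => map (r1 s) E) (fun s => map (r s) E)) => t.
  have := cP _ (map^~ E) t (EK L); rewrite (c1P _ (map^~ E) t (EK1 L)).
  (* The constant invariant gives [#|S| * c1 = #|S| * c], hence [c1 = c] because [S] is not
     empty. *)
  have := cP _ (fun f => tt) tt (fun _ _ _ => erefl).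
  rewrite (c1P _ (fun f => tt) tt (fun _ _ _ => erefl)) eqxx => /eqP.
  have -> : #|[pred j : S | true]| = #|S| by [].
  have Spos : 0 < #|S| by apply/card_gt0P; exists s0.
  rewrite eqn_mul2l eqn0Ngt Spos /= => /eqP-> /eqP.
  rewrite eqn_mul2r => /orP[/eqP c0|/eqP->//].
  have [j _] := transversal_ex rT' (transversal_iso rT s0).
  have := cP _ (fun f => tt) tt (fun _ _ _ => erefl).
  rewrite c0 muln0 => /card0_eq/(_ j).
  by rewrite inE eqxx.
exists sigma => s y yK uyK.
have /eq_in_map := sigmaP s; apply.
by rewrite mem_filter uyK.
Qed.

(** * Gluing *)

Lemma iso_local_iso (K L : complex) (f : K -> L) (g : L -> K) :
  cancel f g -> cancel g f -> simplicial f -> simplicial g -> local_iso f.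
Proof.
move=> fK gK sf sg v.
have fgK s : vimage g (vimage f s) = s.
  rewrite -(vimage_comp f g) -[RHS](@vimage_id K); apply: eq_vimage => y _.
  by rewrite /= fK.
have gfK s : vimage f (vimage g s) = s.
  rewrite -(vimage_comp g f) -[RHS](@vimage_id L); apply: eq_vimage => y _.
  by rewrite /= gK.
split=> [s /starP[ss vs]|s t _ _ e|t /starP[st vt]].
- by apply/starP; split; [exact: sf | exact: mem_vimage].
- by rewrite -(fgK s) e fgK.
- exists (vimage g t); last exact: gfK.
  by apply/starP; split; [exact: sg | rewrite -[v]fK mem_vimage].
Qed.

Lemma deck_inj (X K : complex) (p : X -> K) (G : groupType)
    (rho : G -> X -> X) (g h : G) (y : X) :
  deck_action p rho -> rho g y = rho h y -> g = h.
Proof.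
move=> A e; have /(deck_free A)/(congr1 (fun a => (h * a)%g)) : rho (h^-1 * g)%g y = y.
  by rewrite (deckM A) e -(deckM A) mulVg (deck1 A).
by rewrite mulgA mulgV mul1g mulg1.
Qed.

Lemma multiplicative1 (G H : groupType) (f : {multiplicative G -> H}) :
  f 1%g = 1%g.
Proof. by apply: (mulgI (f 1%g)); rewrite -gmulfM !mulg1. Qed.

Section Gluing.
Variables (X K L : complex) (p : X -> K) (G : groupType) (rho : G -> X -> X).
Variables (S : finType) (phi : {multiplicative G -> {perm S}}).
Hypotheses (p_iso : local_iso p) (rhoA : deck_action p rho).
Variables (base : K -> X) (coord : X -> G).
Hypotheses (baseK : cancel base p).
Hypothesis (coordP : forall y, rho (coord y) (base (p y)) = y).

Let coordM g y : coord (rho g y) = (g * coord y)%g.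
Proof.
apply: (deck_inj (y := base (p y)) rhoA).
by rewrite (deckM rhoA) coordP -{1}(deck_proj rhoA g y) coordP.
Qed.

Let coord_base v : coord (base v) = 1%g.
Proof.
by apply: (deck_inj (y := base v) rhoA); rewrite (deck1 rhoA) -{2}[v]baseK coordP.
Qed.

(* The complex glued below is the quotient of [X * S] by the diagonal action of
   [G]; [sheet s] is the quotient map on [X * {s}]. *)
Definition sheet (s : S) (y : X) : K * S := (p y, phi (coord y) s).

(** Permutations multiply from left to right, which fits precomposition with [rho g]: the quotient
    identifies [(rho g y, s)] with [(y, phi g s)], just as [r s \o rho g] is to match
    [r (phi g s)]. *)
Lemma sheet_translate g s y : sheet s (rho g y) = sheet (phi g s) y.
Proof. by rewrite /sheet (deck_proj rhoA) coordM gmulfM permM. Qed.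

Lemma sheet_base s v : sheet s (base v) = (v, s).
Proof. by rewrite /sheet baseK coord_base multiplicative1 perm1. Qed.

(** Each orbit in [X * S] contains exactly one pair [(base v, s)], so [K * S] can serve as the
    vertex type. *)
Definition glued_simplex : pred {fset K * S} := fun t =>
  `[< exists s a, simplex a /\ t = vimage (sheet s) a >].

Lemma glued_neq0 t : glued_simplex t -> t != fset0.
Proof.
case/asboolP => s [a [/simplex_mem[y ya] ->]].
by apply/fset0Pn; exists (sheet s y); exact: mem_vimage.
Qed.

Lemma glued_sub t t' : glued_simplex t -> (t' `<=` t)%fset -> t' != fset0 ->
  glued_simplex t'.
Proof.
case/asboolP => s [a [sa ->]] /fsubsetP sub /fset0Pn[z zt].
pose a' := [fset y in a | sheet s y \in t']%fset.
have e : t' = vimage (sheet s) a'.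
  apply/fsetP => w; apply/idP/imfsetP => [wt|[y /=]]; last first.
    by rewrite !inE => /andP[_ yt] ->.
  have /imfsetP[y /= ya ew] := sub w wt.
  by exists y => //=; rewrite !inE ya -ew.
apply/asboolP; exists s, a'; split=> //; apply: (simplex_sub sa).
  by apply/fsubsetP => y; rewrite !inE => /andP[].
move: zt; rewrite {1}e => /imfsetP[y /= ya' _].
by apply/fset0Pn; exists y.
Qed.

Lemma glued_vertex z : glued_simplex [fset z]%fset.
Proof.
case: z => v s; apply/asboolP; exists s, [fset base v]%fset.
by split; [exact: simplex_vertex | rewrite imfset_fset1 sheet_base].
Qed.

Definition glued : complex := Complex glued_neq0 glued_sub glued_vertex.

(** Injectivity comes from [p = fst \o sheet s]. For surjectivity, a simplex at [sheet s y] may be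
    given on another sheet; the deck transformation that carries its vertex over [p y] to [y] moves
    it to the sheet [s]. *)
Lemma sheet_iso s : local_iso (sheet s : X -> glued).
Proof.
have psheet t : p = fst \o sheet t by [].
move=> y; split.
- move=> a /starP[sa ya]; apply/starP; split; last exact: mem_vimage.
  by apply/asboolP; exists s, a.
- move=> a b aS bS e; have [_ pinj _] := p_iso y; apply: (pinj a b aS bS).
  by rewrite (psheet s) !(vimage_comp (sheet s) fst) e.
move=> t /starP[/asboolP[s' [a [sa ->]]] /imfsetP[z /= za]].
move=> [epz es]; have [g gz] := deck_trans rhoA (esym epz).
have {}es : s' = phi g s.
  by apply: (@perm_inj _ (phi (coord z))); rewrite -es -gz coordM gmulfM permM.
have lift (b : {fset X}) : vimage (sheet s) (vimage (rho g) b) = vimage (sheet s') b.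
  rewrite -(vimage_comp (rho g) (sheet s)); apply: eq_vimage => w _.
  by rewrite /= sheet_translate es.
exists (vimage (rho g) a); last exact: lift.
apply/starP; split; last by rewrite -gz mem_vimage.
by apply: local_iso_simplicial sa; exact: deck_iso rhoA g.
Qed.

Definition glued_fst (z : glued) : K := z.1.

Lemma glued_fst_iso : local_iso glued_fst.
Proof.
move=> [v s]; rewrite -sheet_base.
exact: star_bij_cancel_left (sheet_iso s (base v)) (p_iso (base v)).
Qed.

Variable r : S -> X -> L.
Hypothesis r_iso : forall s, local_iso (r s).
Hypothesis r_coord : forall s v y, edge (base v) y ->
  r (phi (coord y) s) (base (p y)) = r s y.

Definition glued_snd (z : glued) : L := r z.2 (base z.1).

(** By [r_coord], [glued_snd \o sheet s] equals [r s] on the neighbours of [base v], and the star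
    condition at [base v] depends only on these. *)
Lemma glued_snd_iso : local_iso glued_snd.
Proof.
move=> [v s]; rewrite -sheet_base.
apply: star_bij_cancel_left (sheet_iso s (base v)) _.
by apply: eq_star_bij (r_iso s (base v)) => y /r_coord<-.
Qed.

Lemma glued_finite : finite_complex K -> finite_complex glued.
Proof.
move=> /finite_complex_vertices[V VP].
pose W := [fset z in [seq (v, s) | v <- V, s <- enum S]]%fset.
apply: (@sub_finite_set _ _ [set` fpowerset W]); last exact: finite_fset.
move=> t _; rewrite /= fpowersetE; apply/fsubsetP => -[v s] _.
by rewrite !inE; apply/allpairsP; exists (v, s); rewrite VP mem_enum.
Qed.

Lemma glued_common_cover : finite_complex K -> connected_complex K ->
  connected_complex L -> S -> common_finite_cover K L.
Proof.
move=> finK [[v _] _] cL s; exists glued, glued_fst, glued_snd.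
have fst_iso := glued_fst_iso; have snd_iso := glued_snd_iso.
split; first exact: glued_finite.
- split=> //; first exact: local_iso_simplicial.
  by move=> w; exists (w, s).
- split=> //; first exact: local_iso_simplicial.
  exact: (local_iso_surj snd_iso (v, s) cL).
Qed.

End Gluing.

(** * Construction of the common finite cover *)

Lemma common_cover_of_free (X K L : complex) (p : X -> K) (q : X -> L) (x : X) :
  simply_connected X -> local_iso p -> (forall v, exists y, p y = v) ->
  local_iso q -> finite_complex K -> finite_complex L -> connected_complex K ->
  connected_complex L ->
  free_group (pi1 (p x)) -> common_finite_cover K L.
Proof.
move=> scX p_iso /choice[base baseK] q_iso finK finL cK cL [B freeB].
have [rho rhoA] := monodromy_action x scX p_iso.
have [V VP] := finite_complex_vertices finK.
have /choice[coord coordP] y : exists g, rho g (base (p y)) = y.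
  by apply: (deck_trans rhoA); rewrite baseK.
(* For an edge [e] of [K], the product of the word moves [base e.2] to a neighbour of [base e.1]; a
   pair that is not an edge gets the empty word. *)
have /choice[nbr nbrP] (e : K * K) : exists w, word B w /\
    (edge e.1 e.2 -> edge (base e.1) (rho (wprod w) (base e.2))).
  have [ve|nve] := pselect (edge e.1 e.2); last by exists [::].
  have [|y vy py] := @edge_lift _ _ p (base e.1) e.2 (p_iso _).
    by rewrite baseK.
  have [w wB yw] := free_basis_generates freeB (coord y).
  by exists w; split=> // _; rewrite -yw -py coordP.
(* All translates by suffixes of the word go into [D], since [phi] and [rho] can be compared only
   one letter at a time and inside [D]. The successor in [iota] includes the empty suffix. *)
pose moved e := [seq rho (wprod (drop i (nbr e))) (base e.2) |
  i <- iota 0 (size (nbr e)).+1].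
have [D [cD subD]] := connected_superset
  (x :: flatten [seq moved e | e <- [seq (v, w) | v <- V, w <- V]]) scX.1.
have xD : x \in D by apply: subD; rewrite mem_head.
have movedD e i : i <= size (nbr e) ->
    rho (wprod (drop i (nbr e))) (base e.2) \in D.
  move=> i_le; apply: subD; rewrite inE; apply/orP; right.
  apply/flattenP; exists (moved e).
    by apply/map_f/allpairsP; exists e; rewrite !VP -surjective_pairing.
  by apply/mapP; exists i; rewrite // mem_iota add0n ltnS i_le.
have [S [r rT]] := exists_transversal (X := X) D finL.
have rhoV g : cancel (rho g) (rho g^-1%g).
  by move=> y; rewrite -(deckM rhoA) mulVg (deck1 rhoA).
have rhoV' g : cancel (rho g^-1%g) (rho g).
  by move=> y; rewrite -(deckM rhoA) mulgV (deck1 rhoA).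
have /choice[sigma sigmaP] g := transversal_perm scX finL cD xD rT
  (deck_iso rhoA g) (deck_iso rhoA g^-1%g) (rhoV g) (rhoV' g).
have [phi [phiB _]] := freeB _ sigma.
have phi_letter c s y : letter B c -> y \in D -> rho c y \in D ->
    r (phi c s) y = r s (rho c y).
  move=> [Bc|Bc] yD cyD; first by rewrite phiB // sigmaP.
  (* For the inverse of a basis element, the relation for [c^-1] is used at [rho c y] with index
     [phi c s]. *)
  have := sigmaP c^-1%g (phi c s) (rho c y) cyD; rewrite rhoV => /(_ yD) <-.
  by rewrite -phiB // -permM -gmulfM mulgV multiplicative1 perm1.
(* Induction on the word: the tail is treated with index [phi c s], and then [c] acts at a suffix
   translate, which lies in [D]. *)
have phi_word w s y : word B w ->
    (forall i, i <= size w -> rho (wprod (drop i w)) y \in D) ->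
    r (phi (wprod w) s) y = r s (rho (wprod w) y).
  elim: w s => [|c w IH] s wB wD.
    by rewrite /= multiplicative1 perm1 (deck1 rhoA).
  have wD' i : i <= size w -> rho (wprod (drop i w)) y \in D by exact: (wD i.+1).
  rewrite /= gmulfM permM IH //; last by move=> d dw; apply: wB; rewrite inE dw orbT.
  rewrite (deckM rhoA) phi_letter //.
  - by apply: wB; rewrite mem_head.
  - by have := wD' 0 isT; rewrite drop0.
  - by have := wD 0 isT; rewrite drop0 /= (deckM rhoA).
have r_coord s v y : edge (base v) y -> r (phi (coord y) s) (base (p y)) = r s y.
  move=> vy; have [wB /= wE] := nbrP (v, p y).
  have vpy : edge v (p y).
    by have := simplicial_edge (local_iso_simplicial p_iso) vy; rewrite baseK.
  (* By uniqueness of edge lifts, the neighbour [y] of [base v] is the translate prescribed by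
     [nbr], which identifies [coord y]. *)
  have ey : rho (wprod (nbr (v, p y))) (base (p y)) = y.
    apply: edge_lift_inj (p_iso (base v)) (wE vpy) vy _.
    by rewrite (deck_proj rhoA) baseK.
  have -> : coord y = wprod (nbr (v, p y)).
    by apply: (deck_inj (y := base (p y)) rhoA); rewrite coordP ey.
  rewrite phi_word // ?ey // => i i_le.
  exact: movedD (v, p y) i i_le.
(* The covering [q] has a representative in [S], so [S] is not empty. *)
have [s _] := transversal_ex rT q_iso.
apply: (glued_common_cover p_iso rhoA baseK coordP (transversal_iso rT) r_coord
  finK cK cL s).
Qed.

Theorem corollary3p6 (X1 X2 : complex)
  (finX1 : finite_complex X1) (finX2 : finite_complex X2)
  (conX1 : connected_complex X1) (conX2 : connected_complex X2)
  (freeX1 : free_pi1 X1) (freeX2 : free_pi1 X2)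
  (univ : common_universal_cover X1 X2) :
  common_finite_cover X1 X2.
Proof.
have [U [V [p [q [[[_ p_surj p_iso] scU] [[_ _ q_iso] _] [f [g [fK gK sf sg]]]]]]]] := univ.
have [[v _] _] := conX1; have [x _] := p_surj v.
(* Composing [q] with the isomorphism [f] makes [U] cover both complexes. *)
apply: (common_cover_of_free (p := p) (q := q \o f) (x := x)) => //.
by move=> y; apply: star_bij_comp (iso_local_iso fK gK sf sg y) (q_iso _).
Qed.
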